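(* Let $\mathcal{A}$ be a set of attributes, viewed as propositional atoms. For any propositional knowledge base $K$ over $\mathcal{A}$, there exist embeddings $\mathbf{a}\in\mathbb{R}^m$ of the attributes $a\in\mathcal{A}$ (for some dimension $m$) such that for all $b\in\mathcal{A}$ and $\{a_1,\dots,a_n\}\subseteq\mathcal{A}$: $$b\in \mathrm{Lab}_{\mathrm{relu}}(\mathrm{Emb}_{\mathrm{avg}}(a_1,\dots,a_n)) \iff K\models a_1\wedge\dots\wedge a_n\rightarrow b .$$
   Context: A propositional knowledge base over $\mathcal{A}$ is a set of propositional formulas over the atoms in $\mathcal{A}$, and $\models$ is the standard entailment relation of propositional logic. Each attribute $a\in\mathcal{A}$ is represented by a single vector $\mathbf{a}\in\mathbb{R}^m$, where the number of dimensions $m$ may be chosen arbitrarily large; this same vector is used in both of the following functions. The embedding function $\mathrm{Emb}_{\mathrm{avg}}:2^{\mathcal{A}}\rightarrow\mathbb{R}^m$ is given by $\mathrm{Emb}_{\mathrm{avg}}(a_1,\dots,a_n)=\frac{1}{n}(\mathbf{a}_1+\dots+\mathbf{a}_n)$, where $\mathbf{a}_i$ is the vector of $a_i$. The labelling function $\mathrm{Lab}_{\mathrm{relu}}:\mathbb{R}^m\rightarrow 2^{\mathcal{A}}$ is given by $\mathrm{Lab}_{\mathrm{relu}}(\mathbf{e})=\{b\in\mathcal{A}\mid \mathrm{ReLU}(\mathbf{e})\cdot\mathbf{b}\geq 0\}$, where $\mathrm{ReLU}(t)=\max(t,0)$ is applied component-wise.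
   Formalization: The set of attributes is taken to be finite (for infinite sets the averaging embedding is not defined on all subsets and the claim fails in any fixed finite dimension), and the set of attributes a_1,…,a_n is taken to be nonempty so that 1/n makes sense. *)

(* Defs.v *)
From HB Require Import structures.
From mathcomp Require Import all_boot all_order all_algebra.
From mathcomp Require Import reals.

Set Implicit Arguments.
Unset Strict Implicit.
Unset Printing Implicit Defensive.

Import Order.TTheory GRing.Theory Num.Theory.
Local Open Scope ring_scope.

Inductive formula (A : Type) : Type :=
  | FAtom of A
  | FTop
  | FBot
  | FNot of formula A
  | FAnd of formula A & formula A
  | FOr of formula A & formula A
  | FImp of formula A & formula A.

Arguments FTop {A}.
Arguments FBot {A}.

Fixpoint feval (A : Type) (v : A -> bool) (f : formula A) : bool :=
  match f with
  | FAtom a => v a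
  | FTop => true
  | FBot => false
  | FNot g => ~~ feval v g
  | FAnd g h => feval v g && feval v h
  | FOr g h => feval v g || feval v h
  | FImp g h => feval v g ==> feval v h
  end.

(* Knowledge bases are arbitrary, possibly infinite, sets of formulas. *)
Definition knowledge_base (A : Type) : Type := formula A -> Prop.

Definition entails (A : Type) (K : knowledge_base A) (f : formula A) : Prop :=
  forall v : A -> bool, (forall g, K g -> feval v g) -> feval v f.

(* The atoms of X are conjoined in the order of enum X; the innermost
   conjunct is FTop, so that the empty conjunction is FTop. *)
Definition conj_atoms (A : finType) (X : {set A}) : formula A :=
  \big[@FAnd A/FTop]_(a in X) FAtom a.

(* For X empty this is 0, since 0^-1 = 0; the average is meaningful only for
   nonempty X. *)
Definition Emb_avg (R : realType) (A : finType) (m : nat)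
    (emb : A -> 'rV[R]_m) (X : {set A}) : 'rV[R]_m :=
  #|X|%:R^-1 *: \sum_(a in X) emb a.

Definition relu (R : realType) (t : R) : R := Num.max t 0.

Definition ReLU (R : realType) (m : nat) (e : 'rV[R]_m) : 'rV[R]_m :=
  map_mx (@relu R) e.

Definition dotv (R : realType) (m : nat) (u v : 'rV[R]_m) : R :=
  \sum_(i < m) u 0 i * v 0 i.

Definition Lab_relu (R : realType) (A : finType) (m : nat)
    (emb : A -> 'rV[R]_m) (e : 'rV[R]_m) : {set A} :=
  [set b : A | 0 <= dotv (ReLU e) (emb b)].

(* Main.v *)
(** Use one coordinate per set [M] of atoms. If [M] is a model of [K], the
    [M]-coordinate of an atom is [1] when the atom is in [M] and a large negative
    number [-N] otherwise; if [M] is not a model it is [0]. For nonempty [X], the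
    ReLU of the average over [X] is then the indicator of the models of [K]
    containing [X]: a single atom outside [M] outweighs all the others. Hence the
    score of [b] counts [+1] for each such model containing [b] and [-N] for each
    one omitting [b], and is nonnegative iff none omits [b]. *)
Require Import Defs.
From HB Require Import structures.
From mathcomp Require Import all_boot all_order all_algebra.
From mathcomp Require Import boolp reals.

Set Implicit Arguments.
Unset Strict Implicit.
Unset Printing Implicit Defensive.

Import Order.TTheory GRing.Theory Num.Theory.
Local Open Scope ring_scope.

Lemma eq_feval (A : Type) (v w : A -> bool) : v =1 w -> feval v =1 feval w.
Proof.
move=> vw; elim=> //= [g -> //|g -> h -> //|g -> h -> //|g -> h -> //].
Qed.

Lemma feval_conj_atoms (A : finType) (v : A -> bool) (X : {set A}) :
  feval v (conj_atoms X) = [forall a in X, v a].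
Proof.
rewrite /conj_atoms (big_morph (feval v) (id1 := true) (op1 := andb)) //=.
by rewrite big_andE.
Qed.

(** As [K] is an arbitrary predicate, classical [boolp] makes modelhood a boolean, usable to select
    coordinates and filter sums. *)
Definition is_model (A : finType) (K : knowledge_base A) (M : {set A}) : bool :=
  `[< forall g, K g -> feval (fun a => a \in M) g >].

Lemma entails_atomP (A : finType) (K : knowledge_base A) (X : {set A}) (b : A) :
  entails K (FImp (conj_atoms X) (FAtom b)) <->
  forall M : {set A}, is_model K M -> X \subset M -> b \in M.
Proof.
split=> [Kb M /asboolP KM XM | Kb v Kv].
  have /= := Kb _ KM; rewrite feval_conj_atoms => /implyP; apply.
  by apply/forall_inP => a /(subsetP XM).
(* A valuation is traded for its set of true atoms. *)
have vE : (fun a => a \in [set a | v a]) =1 v by move=> a; rewrite inE.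
rewrite /= feval_conj_atoms; apply/implyP => /forall_inP Xv.
have := Kb [set a | v a]; rewrite inE; apply.
  by apply/asboolP => g /Kv; rewrite (eq_feval vE).
by apply/subsetP => a /Xv; rewrite inE.
Qed.

Section Weights.
Variables (R : realType) (A : finType).

Definition weight (N : nat) (M : {set A}) (a : A) : R :=
  if a \in M then 1 else - N%:R.

Lemma weight_le1 N M a : weight N M a <= 1.
Proof.
by rewrite /weight; case: ifP => // _; rewrite (le_trans _ ler01) // oppr_le0.
Qed.

Lemma relu_avg_weight N (M X : {set A}) : X != set0 -> (#|A| <= N)%N ->
  relu (#|X|%:R^-1 * \sum_(a in X) weight N M a) = (X \subset M)%:R.
Proof.
move=> X0 AN; rewrite /relu; case: (boolP (X \subset M)) => [XM|].
  rewrite (eq_bigr (fun=> 1)); last by move=> a /(subsetP XM) aM; rewrite /weight aM.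
  rewrite sumr_const mulVf ?pnatr_eq0 ?cards_eq0 //.
  by rewrite max_l.
(* The atom [a] contributes [-N] and the others at most [#|A| <= N] together, so the average is
   nonpositive and is clipped to 0. *)
case/subsetPn => a aX aM; rewrite max_r //.
rewrite mulr_ge0_le0 ?invr_ge0 // (bigD1 a) //= {1}/weight (negPf aM).
rewrite addrC subr_le0.
apply: (le_trans (ler_sum _ (fun i _ => weight_le1 N M i))).
rewrite sumr_const ler_nat (leq_trans _ AN) //.
exact: max_card.
Qed.

(** One set omitting [b] costs [N], while the other sets give at most [#|{set A}|]; the strict bound
    makes the sum strictly negative. *)
Lemma sum_weight_ge0 N (P : pred {set A}) b : (#|{set A}| < N)%N ->
  0 <= \sum_(M | P M) weight N M b <-> (forall M, P M -> b \in M).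
Proof.
move=> ltN; split=> [ge0 M PM | Pb]; last first.
  by apply: sumr_ge0 => M PM; rewrite /weight Pb.
apply: contraLR ge0 => bM; rewrite -ltNge (bigD1 M) //= {1}/weight (negPf bM).
rewrite addrC subr_lt0.
apply: (le_lt_trans (ler_sum _ (fun i _ => weight_le1 N i b))).
rewrite sumr_const ltr_nat (leq_ltn_trans _ ltN) //.
exact: max_card.
Qed.

End Weights.

Theorem proposition1 (R : realType) (A : finType) (K : knowledge_base A) :
  exists (m : nat) (emb : A -> 'rV[R]_m),
    forall (b : A) (X : {set A}), X != set0 ->
      (b \in Lab_relu emb (Emb_avg emb X) <->
       entails K (FImp (conj_atoms X) (FAtom b))).
Proof.
(* This [N] meets both bounds: at least [#|A|], and above [#|{set A}|]. *)
pose N := (#|A| + #|{set A}|.+1)%N.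
exists #|{set A}|, (fun a => \row_i
  (let M := enum_val i in if is_model K M then weight R N M a else 0)).
move=> b X X0; rewrite inE /dotv.
set s := (X in 0 <= X).
have -> : s = \sum_(M | is_model K M && (X \subset M)) weight R N M b.
  rewrite big_mkcond (reindex (enum_val (A := {set A}))) /=; last first.
    by apply: onW_bij; apply: enum_val_bij.
  apply: eq_bigr => i _; rewrite !mxE summxE.
  under eq_bigr => a _ do rewrite mxE.
  (* Off the models, the coordinate of [b] is 0 and kills the term. *)
  case: ifP => KM /=; last by rewrite mulr0.
  by rewrite relu_avg_weight ?leq_addr // -[RHS]mulrb mulr_natl.
rewrite entails_atomP sum_weight_ge0; last by rewrite leq_addl.
split=> [Kb M KM XM | Kb M /andP[]]; last exact: Kb.
by apply: Kb; rewrite KM.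
Qed.
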